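(* Let $p$ be a prime. A $p$-group of rank at most $5$, i.e. a group of order $p^n$ with $n\le 5$, is totally unramified if and only if it is totally pseudo-unramified.
   Context: A $p$-group of rank $n$ means a group of order $p^n$. All representations and characters are complex. A representation (or its character) is multiplicity free if every irreducible constituent occurs with multiplicity one; a restriction $\rho|_N$ is called trivial if every element of $N$ acts as the identity. A finite group $G$ is unramified over a nontrivial abelian normal subgroup $N$ if for every irreducible representation $\rho$ of $G$ the restriction $\rho|_N$ is multiplicity free or trivial. A finite group $G$ is totally unramified (recursively) if it is abelian or there exists a nontrivial abelian normal subgroup $N$ such that $G$ is unramified over $N$ and $G/N$ is totally unramified. A finite group $G$ is pseudo-unramified over a nontrivial abelian normal subgroup $N$ if for every $\mu\in\mathrm{Irr}(N)$ there exists $\chi\in\mathrm{Irr}(G)$ with $\langle\chi|_N,\mu\rangle>0$ such that $\chi|_N$ is multiplicity free. A finite group $G$ is totally pseudo-unramified (recursively) if it is abelian or there exists a nontrivial abelian normal subgroup $N$ such that $G$ is pseudo-unramified over $N$ and $G/N$ is totally pseudo-unramified. *)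

(* Defs.v *)
(* Finite group and character theory over algC, in Mathematical Components.   *)
From mathcomp Require Import all_boot all_order all_fingroup all_algebra.
From mathcomp Require Import all_solvable all_field all_character.

Set Implicit Arguments.
Unset Strict Implicit.
Unset Printing Implicit Defensive.

Import Order.TTheory GroupScope GRing.Theory Num.Theory.
Local Open Scope ring_scope.

Section Ramification.

Variable gT : finGroupType.

Definition multiplicity_free (G : {group gT}) (phi : 'CF(G)) : bool :=
  [forall i in irr_constt phi, '[phi, 'chi_i] == 1].

Definition nontrivial_abelian_normal (G N : {group gT}) : bool :=
  [&& N :!=: 1%g, abelian N & N <| G].

Definition unramified_over (G N : {group gT}) : Prop :=
  nontrivial_abelian_normal G N /\
  forall (n : nat) (rho : mx_representation algC G n), mx_irreducible rho ->
    multiplicity_free ('Res[N] (cfRepr rho)) \/ N \subset rker rho.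

Definition pseudo_unramified_over (G N : {group gT}) : Prop :=
  nontrivial_abelian_normal G N /\
  forall mu : Iirr N, exists i : Iirr G,
    0 < '['Res[N] 'chi[G]_i, 'chi[N]_mu] /\
    multiplicity_free ('Res[N] 'chi[G]_i).

End Ramification.

(* The ambient type is a non-uniform parameter because G / N lives in the     *)
(* type coset_of N. The recursion is well founded as #|G / N| < #|G|, so the  *)
(* least fixpoint is the recursively defined property.                        *)
Inductive totally_unramified (gT : finGroupType) (G : {group gT}) : Prop :=
  | TotUnramAbelian of abelian G
  | TotUnramStep (N : {group gT}) of
      unramified_over G N & totally_unramified (G / N)%G.

Inductive totally_pseudo_unramified
    (gT : finGroupType) (G : {group gT}) : Prop :=
  | TotPseudoUnramAbelian of abelian G
  | TotPseudoUnramStep (N : {group gT}) of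
      pseudo_unramified_over G N & totally_pseudo_unramified (G / N)%G.

(* Main.v *)
Require Import Defs.
From mathcomp Require Import all_boot all_order all_fingroup all_algebra.
From mathcomp Require Import all_solvable all_field all_character.

(* Unramified always implies pseudo-unramified, so only the converse matters.
   A p-group with an abelian maximal subgroup A is totally unramified: every
   irreducible character restricts to A without multiplicity. Every group of
   order at most p^4 has such an A. If |G| = p^5 is pseudo-unramified over N,
   then N meets the derived subgroup of 'C_G(N) trivially; for |N| <= p^2 this
   forces an abelian maximal subgroup, since 'C_G(N) has index at most p. For
   |N| >= p^3 the quotient G / N is abelian, and then Gallagher's argument
   turns pseudo-unramified over N into unramified over N. *)

Set Implicit Arguments.
Unset Strict Implicit.
Unset Printing Implicit Defensive.

Import Order.TTheory GroupScope GRing.Theory Num.Theory.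

(** * Restricting irreducible characters to abelian normal subgroups *)

Section Ramification.

Local Open Scope ring_scope.

Variable gT : finGroupType.
Implicit Types G N A B : {group gT}.

Lemma multiplicity_freeP G (phi : 'CF(G)) :
  reflect (forall i, i \in irr_constt phi -> '[phi, 'chi_i] = 1)
          (multiplicity_free phi).
Proof. by apply: (iffP forall_inP) => H i /H/eqP. Qed.

Lemma multiplicity_free_irr G (i : Iirr G) : multiplicity_free 'chi_i.
Proof.
by apply/multiplicity_freeP => j; rewrite constt_irr => /eqP->; rewrite cfnorm_irr.
Qed.

(** The principal character of [G] serves [mu = 0]. For any other [mu], take a constituent of the
    induced character: were [N] in its kernel, its restriction would be a multiple of the principal
    character, excluding [mu]. *)
Lemma unramified_pseudo_unramified G N :
  unramified_over G N -> pseudo_unramified_over G N.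
Proof.
case=> ntN unrN; split=> // mu; have [_ _ /andP[sNG _]] := and3P ntN.
have [mu0 | nz_mu] := eqVneq mu 0.
  have Res0: 'Res[N] 'chi[G]_0 = 'chi_0 by rewrite !irr0 cfRes_cfun1.
  by exists 0; rewrite Res0 mu0 cfnorm_irr ltr01 multiplicity_free_irr.
have [i] := constt_cfInd_irr mu sNG; rewrite constt_Ind_Res => mu_i.
exists i; split.
  by rewrite lt0r -irr_consttE mu_i natr_ge0 ?Cnat_cfdot_char_irr ?cfRes_char ?irr_char.
have [|kerN] := unrN _ _ (socle_irr (socle_of_Iirr i)); rewrite ?irrRepr //.
move: kerN; rewrite -cfker_repr irrRepr => kerN.
move: mu_i; rewrite irr_consttE (cfRes_sub_ker kerN) cfdotZl -irr0 cfdot_irr.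
by rewrite [_ == mu]eq_sym (negPf nz_mu) mulr0 eqxx.
Qed.

(* A constituent of the restriction to C = 'C_G(N) of a character that is
   multiplicity free on N is homogeneous on N, hence linear, so C^`(1) lies in
   its kernel. *)
Lemma pseudo_unramified_TI_der1_cent G N :
  pseudo_unramified_over G N -> N :&: 'C_G(N)^`(1)%g = 1%g.
Proof.
case=> /and3P[_ cNN /andP[sNG nNG]] psN.
set C := 'C_G(N)%G; have sCG: C \subset G by apply: subsetIl.
have sNC: N \subset C by rewrite subsetI sNG.
have sNZ: N \subset 'Z(C) by rewrite subsetI sNC centsC subsetIr.
apply/trivgP; rewrite -(TI_cfker_irr N); apply/bigcapsP=> mu _.
have [i [mu_i /multiplicity_freeP mf_i]] := psN mu.
have {}mu_i: mu \in irr_constt ('Res[N] 'chi_i).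
  by rewrite irr_consttE (gt_eqF mu_i).
have [j ij muj]: exists2 j, j \in irr_constt ('Res[C] 'chi_i)
    & mu \in irr_constt ('Res[N] 'chi_j).
  have [/existsP[j /andP[]] | ] := boolP [exists j,
    (j \in irr_constt ('Res[C] 'chi_i)) && (mu \in irr_constt ('Res[N] 'chi_j))].
    by exists j.
  rewrite negb_exists => /forallP no_j; case/negP: mu_i.
  rewrite -(cfResRes _ sNC sCG) ['Res[C] _]cfun_sum_constt linear_sum cfdot_suml.
  rewrite big1 // => j Cj; move: (no_j j); rewrite Cj /= negbK linearZ cfdotZl.
  by move/eqP->; rewrite mulr0.
have lin_j: 'chi_j \is a linear_char.
  (* As [N] is central in [C], the restriction of ['chi_j] to [N] is ['chi_j 1] copies of one linear
     character, so the degree is a multiplicity, bounded by that of [mu] in ['chi_i]. *)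
  have [lam lin_lam Dlam] := cfcenter_Res 'chi_j.
  have sNZj: N \subset 'Z('chi_j)%CF.
    by rewrite (subset_trans sNZ) // -cap_cfcenter_irr bigcap_inf.
  have DN: 'Res[N] 'chi_j = 'chi_j 1%g *: 'Res[N] lam.
    by rewrite -(cfResRes _ sNZj (cfcenter_sub _)) Dlam linearZ.
  have /irrP[k Dk]: 'Res[N] lam \in irr N by rewrite lin_char_irr ?cfRes_lin_char.
  have le1: '['Res[N] 'chi_j, 'chi_mu] <= 1.
    rewrite -(mf_i _ mu_i) -(cfResRes _ sNC sCG).
    by apply: cfdot_Res_ge_constt; rewrite ?cfRes_char ?irr_char.
  move: muj le1; rewrite irr_consttE DN Dk cfdotZl cfdot_irr.
  case: (k =P mu) => [_ _|_]; last by rewrite mulr0 eqxx.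
  rewrite mulr1 qualifE/= irr_char => le1; rewrite eq_le le1 /=.
  have := irr1_gt0 j; rewrite irr1_degree ltr0n => j_gt0.
  by rewrite ler1n.
apply: subset_trans (cfker_constt (cfRes_char _ (irr_char j)) muj).
by rewrite cfker_Res ?irr_char // setIS // -lin_irr_der1.
Qed.

(* Gallagher: since G / N is abelian, two irreducible characters of G with a
   common constituent on N differ by a linear character trivial on N. *)
Lemma pseudo_unramified_abelian_quotient G N :
  pseudo_unramified_over G N -> abelian (G / N) -> unramified_over G N.
Proof.
case=> ntN psN abGN; split=> // n rho irr_rho; left.
have [_ _ nsNG] := and3P ntN; have [sNG nNG] := andP nsNG.
have /irrP[k ->]: cfRepr rho \in irr G.
  by apply/irr_reprP; exists (Representation rho).
have [mu mu_k] := constt_cfRes_irr N k.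
have [i [mu_i mf_i]] := psN mu.
have {}mu_i: mu \in irr_constt ('Res[N] 'chi_i).
  by rewrite irr_consttE (gt_eqF mu_i).
(* Twisting by a linear character trivial on [N] does not change the restriction, so [mf_i] passes
   to ['chi_k]. *)
suff [l lin_l Dk]: exists2 l : Iirr G, N \subset cfker 'chi_l
    & 'chi_k = 'chi_l * 'chi_i.
  have ll: 'chi_l \is a linear_char.
    by rewrite lin_irr_der1 (subset_trans _ lin_l) ?der1_min.
  by rewrite Dk rmorphM /= cfRes_sub_ker // lin_char1 // scale1r mul1r.
(* Frobenius reciprocity applied to the shared constituent [mu]. The induced character equals
   ['Ind[G, N] 1 * 'chi_i], and the constituents of ['Ind[G, N] 1] are linear, being trivial on
   [N]. *)
have nz: '['chi_k, 'Ind[G] ('Res[N] 'chi_i)] != 0.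
  rewrite -cfdot_Res_l; apply/eqP=> /(constt_ortho_char _ _ mu_k mu_i).
  by rewrite !cfRes_char ?irr_char // cfnorm_irr => /(_ isT isT)/eqP; rewrite oner_eq0.
rewrite -['Res[N] _]mul1r cfIndM // in nz.
have [/existsP[l /andP[Cl nzl]] | ] := boolP [exists l,
  (l \in irr_constt ('Ind[G, N] 1)) && ('['chi_k, 'chi_l * 'chi_i] != 0)].
  have Nl: N \subset cfker 'chi_l.
    apply: subset_trans (cfker_constt (cfInd_char _ (cfun1_char _)) Cl).
    by rewrite -irr0 cfker_Ind_irr // sub_gcore // cfker_irr0.
  have ll: 'chi_l \is a linear_char.
    by rewrite lin_irr_der1 (subset_trans _ Nl) ?der1_min.
  exists l => //; have /irrP[m Dm] := mul_lin_irr ll (mem_irr i).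
  by move: nzl; rewrite Dm cfdot_irr; case: (k =P m) => [->//|_]; rewrite eqxx.
rewrite negb_exists => /forallP no_l; case/negP: nz.
rewrite ['Ind _]cfun_sum_constt mulr_suml cfdot_sumr big1 // => l Cl.
move: (no_l l); rewrite Cl /= negbK -scalerAl cfdotZr => /eqP->.
by rewrite mulr0.
Qed.

(** Clifford theory at prime index: the restriction is either irreducible or a sum of pairwise
    distinct irreducibles. *)
Lemma prime_index_unramified G A :
    A :!=: 1%g -> abelian A -> A <| G -> prime #|G : A| -> unramified_over G A.
Proof.
move=> ntA cAA nsAG pr_i; split; first exact/and3P.
move=> n rho irr_rho; left.
have /irrP[k ->]: cfRepr rho \in irr G.
  by apply/irr_reprP; exists (Representation rho).
have [/irrP[j ->] | [c inj_c ->]] := cfRes_prime_irr_cases k nsAG (erefl _) pr_i.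
  exact: multiplicity_free_irr.
have cfc j: '[\sum_(i < #|G : A|) 'chi_(c i), 'chi_j] = (j \in codom c)%:R.
  rewrite cfdot_suml; have [/codomP[i ->] | c'j] := boolP (j \in codom c).
    rewrite (bigD1 i) //= cfnorm_irr big1 ?addr0 // => i' i'i.
    by rewrite cfdot_irr (inj_eq inj_c) (negPf i'i).
  rewrite big1 // => i _; rewrite cfdot_irr; case: eqP => // Dj.
  by rewrite -Dj codom_f in c'j.
apply/multiplicity_freeP=> j; rewrite irr_consttE cfc.
by case: (j \in _); rewrite ?eqxx.
Qed.

Lemma prime_index_totally_unramified G A :
    abelian A -> A <| G -> prime #|G : A| -> totally_unramified G.
Proof.
move=> cAA nsAG pr_i; have [sAG nAG] := andP nsAG.
have cGA: abelian (G / A).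
  by apply/cyclic_abelian/prime_cyclic; rewrite card_quotient.
(* A trivial [A] cannot serve as a ramification subgroup, but then [G] has prime order. *)
have [A1 | ntA] := eqVneq (A : {set gT}) 1%g.
  apply: TotUnramAbelian; apply/cyclic_abelian/prime_cyclic.
  by rewrite -indexg1 -A1.
apply: (TotUnramStep (N := A)); last exact: TotUnramAbelian.
exact: prime_index_unramified.
Qed.

End Ramification.

Lemma totally_unramified_pseudo_unramified (gT : finGroupType) (G : {group gT}) :
  totally_unramified G -> totally_pseudo_unramified G.
Proof.
elim=> {gT G} [gT G cGG | gT G N unrN _ IH]; first exact: TotPseudoUnramAbelian.
by apply: TotPseudoUnramStep IH; apply: unramified_pseudo_unramified.
Qed.

(** * Centralizers and abelian subgroups of index p in small p-groups *)

Section SmallPGroups.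

Variables (gT : finGroupType) (p : nat).
Implicit Types G N A B : {group gT}.

(* If N is not central, 'C_G(N) = 'C_G[x] for any noncentral x in N, and the
   class of x has fewer than p ^ 2 elements. *)
Lemma index_cent_small_normal G N :
    prime p -> p.-group G -> N <| G -> (logn p #|N| <= 2)%N ->
  (#|G : 'C_G(N)| %| p)%N.
Proof.
move=> pr_p pG nsNG leN2; have [sNG nNG] := andP nsNG.
have pN := pgroupS sNG pG.
have [cNG | ] := boolP (G \subset 'C(N)); first by rewrite (setIidPl cNG) indexgg dvd1n.
rewrite centsC => /subsetPn[x Nx notcx]; have Gx := subsetP sNG x Nx.
have oN: (#|N| <= p ^ 2)%N.
  by rewrite (card_pgroup pN) leq_exp2l ?prime_gt1.
have ntN: N :!=: 1%g.
  by apply: contraNneq notcx => N1; move: Nx; rewrite N1 => /set1P->; apply: group1.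
have ntZ: N :&: 'Z(G) != 1%g.
  by apply: contra ntN => /eqP/(TI_center_nil (pgroup_nil pG) nsNG)->.
(* [Y] contains [N :&: 'Z(G)], of order at least [p], and also the noncentral [x]; so its order is
   at least [p ^ 2] and it fills [N]. *)
have cN: 'C_G[x] \subset 'C(N).
  rewrite centsC; set Y := 'C_N('C_G[x])%G.
  suff <-: Y = N :> {set gT} by apply: subsetIr.
  apply/eqP; rewrite eqEcard subsetIl /=.
  have ltZY: N :&: 'Z(G) \proper Y.
    apply/properP; split.
      by rewrite setIS // subIset // orbC centS // subsetIl.
    exists x; last by rewrite !inE (negPf notcx) !andbF.
    by rewrite inE Nx; apply/centP => y /setIP[_ /cent1P].
  have ltc: (p < #|Y|)%N.
    apply: leq_ltn_trans (proper_card ltZY).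
    have [_ pZ _] := pgroup_pdiv (pgroupS (subsetIl _ _) pN) ntZ.
    exact: dvdn_leq.
  have pY: p.-group Y := pgroupS (subsetIl _ _) pN.
  apply: leq_trans oN _; move: ltc; rewrite (card_pgroup pY).
  have p_gt1 := prime_gt1 pr_p.
  by rewrite leq_exp2l // -(ltn_exp2l 1 _ p_gt1) expn1.
have ->: 'C_G(N) = 'C_G[x].
  apply/eqP; rewrite eqEsubset [X in _ && X]subsetI subsetIl cN !andbT setIS //.
  by rewrite -cent_set1 centS // sub1set.
rewrite index_cent1.
have pc: p.-nat #|x ^: G| by rewrite -index_cent1; apply: pnat_dvd (dvdn_indexg _ _) pG.
have [m Dm] := p_natP pc.
suff: (#|x ^: G| < p ^ 2)%N.
  by rewrite Dm ltn_exp2l ?prime_gt1 // ltnS => le1; rewrite (dvdn_exp2l _ le1).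
apply: leq_trans oN; apply: proper_card; apply/properP; split.
  by rewrite class_sub_norm.
exists 1%g => //; rewrite class_sym class1G inE.
by apply: contraNneq notcx => ->; apply: group1.
Qed.

(** Either [N] is central and any maximal subgroup containing it works, or ['C_G(N)] itself has
    index [p]. *)
Lemma index_p_cent_small_normal G N :
    prime p -> p.-group G -> N \proper G -> N <| G -> (logn p #|N| <= 2)%N ->
    abelian N ->
  exists B, [/\ B <| G, #|G : B| = p, N \subset B & B \subset 'C(N)].
Proof.
move=> pr_p pG ltNG nsNG leN2 cNN; have [sNG nNG] := andP nsNG.
have sNC: N \subset 'C_G(N) by rewrite subsetI sNG.
have nsCG: 'C_G(N) <| G by rewrite /normal subsetIl normsI ?normG ?norms_cent.
have /(primeP pr_p).2/pred2P[iC | iC] := index_cent_small_normal pr_p pG nsNG leN2.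
  have cNG: G \subset 'C(N) by move/eqP: iC; rewrite indexg_eq1 subsetI subxx.
  have [NG | [B maxB sNB]] := maximal_exists sNG.
    by rewrite NG properxx in ltNG.
  exists B; rewrite (p_maximal_normal pG maxB) (p_maximal_index pG maxB) sNB.
  by split=> //; apply: subset_trans (proper_sub (maxgroupp maxB)) cNG.
by exists ('C_G(N))%G; rewrite nsCG iC sNC subsetIr.
Qed.

Lemma abelian_index_p_small G n :
    prime p -> (n <= 3)%N -> #|G| = (p ^ n.+1)%N ->
  exists A, [/\ abelian A, A <| G & #|G : A| = p].
Proof.
move=> pr_p le3 oG; have p_gt1 := prime_gt1 pr_p.
have pG: p.-group G by rewrite /pgroup oG pnatX pnat_id.
(* The exponent [minn 2 n] keeps [N] proper and abelian, yet leaves [B / N] of order at most [p];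
   [B] is then cyclic modulo a central subgroup. *)
have [|N [_ nsNG oN]] := @normal_pgroup p _ (minn 2 n) _ _ pG (normal_refl G).
  by rewrite oG pfactorK // geq_min leqnSn orbT.
have sNG := normal_sub nsNG.
have lN: (logn p #|N| <= 2)%N by rewrite oN pfactorK // geq_minl.
have cNN: abelian N by rewrite (p2group_abelian (pgroupS sNG pG)).
have ltNG: N \proper G.
  by rewrite properEcard sNG oN oG ltn_exp2l // ltnS geq_minr.
have [B [nsBG iB sNB cNB]] := index_p_cent_small_normal pr_p pG ltNG nsNG lN cNN.
exists B; split=> //; have sBG := normal_sub nsBG.
have sNZ: N \subset 'Z(B) by rewrite subsetI sNB centsC.
apply: (cyclic_factor_abelian sNZ).
have oB: #|B| = (p ^ n)%N.
  apply/eqP; rewrite -(eqn_pmul2r (prime_gt0 pr_p)) -expnSr -oG -iB.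
  by rewrite Lagrange.
have oBN: #|B / N| = (p ^ (n - minn 2 n))%N.
  rewrite card_quotient ?(subset_trans sBG) ?normal_norm //.
  by rewrite -divgS // oB oN -expnB ?prime_gt0 // geq_minr.
have: (n - minn 2 n <= 1)%N by move: le3; case: n {oG oN oB oBN} => [|[|[|[|]]]].
case: (n - _)%N oBN => [|[|//]] oBN _.
  by rewrite (card1_trivg oBN) cyclic1.
by rewrite prime_cyclic // oBN.
Qed.

End SmallPGroups.

Lemma totally_unramified_order_p4 (p n : nat) (gT : finGroupType) (G : {group gT}) :
  prime p -> (n <= 4)%N -> #|G| = (p ^ n)%N -> totally_unramified G.
Proof.
case: n => [|n] pr_p le_n oG.
  by apply: TotUnramAbelian; rewrite (card1_trivg oG) abelian1.
have [A [cAA nsAG iA]] := abelian_index_p_small pr_p le_n oG.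
by apply: prime_index_totally_unramified nsAG _; rewrite ?iA.
Qed.

(** * Groups of order p^5 *)

Lemma pseudo_unramified_small_abelian_index_p
    (p : nat) (gT : finGroupType) (G N : {group gT}) :
    prime p -> #|G| = (p ^ 5)%N -> (logn p #|N| <= 2)%N ->
    pseudo_unramified_over G N ->
  exists A : {group gT}, [/\ abelian A, A <| G & #|G : A| = p].
Proof.
move=> pr_p oG lN psN; have TI := pseudo_unramified_TI_der1_cent psN.
have [[/and3P[ntN cNN nsNG]] _] := psN; have [sNG nNG] := andP nsNG.
have p_gt1 := prime_gt1 pr_p.
have pG: p.-group G by rewrite /pgroup oG pnatX pnat_id.
have pN := pgroupS sNG pG; have oN := card_pgroup pN.
(* Here [B^](1)[lies both in]N[and in]'C_G(N)^[(1)], which meet trivially. *)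
have abelB (B : {group gT}) : B \subset G -> B \subset 'C(N) -> N \subset B ->
    abelian (B / N) -> abelian B.
  move=> sBG cNB sNB abBN.
  have sB'N: B^`(1)%g \subset N by rewrite der1_min // (subset_trans sBG).
  have: B^`(1) \subset 1%G.
    by rewrite /= -TI subsetI sB'N dergS // subsetI sBG.
  by move/trivgP/commG1P.
have ltNG: N \proper G.
  by rewrite properEcard sNG oN oG ltn_exp2l // (leq_ltn_trans lN).
have l_gt0: (0 < logn p #|N|)%N.
  by have [_ _ [m ->]] := pgroup_pdiv pN ntN; rewrite pfactorK.
(* If [N] has order [p ^ 2], so does [B / N], which is thus abelian. If [N] has order [p], it is
   central, and [B] is the preimage of an abelian subgroup of index [p] in [G / N]. *)
have [l2 | l1]: logn p #|N| = 2 \/ logn p #|N| = 1%N.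
  by case: (logn p #|N|) lN l_gt0 => [|[|[|]]] //; [right | left].
  have [B [nsBG iB sNB cNB]] := index_p_cent_small_normal pr_p pG ltNG nsNG lN cNN.
  exists B; split=> //; have sBG := normal_sub nsBG; apply: abelB => //.
  apply: (card_p2group_abelian pr_p); apply/eqP.
  rewrite -(eqn_pmul2r (prime_gt0 pr_p)) -expnSr -{1}iB.
  rewrite card_quotient ?(subset_trans sBG) // mulnC Lagrange_index //.
  by rewrite -divgS // oG oN l2 -expnB ?prime_gt0.
have cNG: G \subset 'C(N).
  have ntZ: N :&: 'Z(G) != 1.
    by apply: contraNneq ntN => /(TI_center_nil (pgroup_nil pG) nsNG)->.
  have: N \subset 'Z(G) by rewrite prime_meetG // oN l1.
  by rewrite subsetI centsC => /andP[].
have oGN: #|G / N| = (p ^ 4)%N.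
  by rewrite card_quotient // -divgS // oG oN l1 -expnB ?prime_gt0.
have [A [cAA nsAG iA]] := abelian_index_p_small pr_p (leqnn 3) oGN.
have [B defA sNB nsBG] := inv_quotientN nsNG nsAG.
have sBG := normal_sub nsBG; exists B; split=> //.
  by apply: abelB; rewrite ?(subset_trans sBG) // -defA.
by rewrite -iA defA index_quotient_eq // subIset ?sNB ?orbT.
Qed.

Theorem proposition6p9 (p n : nat) (gT : finGroupType) (G : {group gT})
    (hp : prime p) (hn : (n <= 5)%N) (hG : #|G| = (p ^ n)%N) :
  totally_unramified G <-> totally_pseudo_unramified G.
Proof.
split; first exact: totally_unramified_pseudo_unramified.
case=> [cGG | N psN _]; first exact: TotUnramAbelian.
move: hn; rewrite leq_eqVlt => /predU1P[n5 | lt5]; last first.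
  exact: totally_unramified_order_p4 hp lt5 hG.
rewrite {n}n5 in hG.
have [le2 | gt2] := leqP (logn p #|N|) 2.
  have [A [cAA nsAG iA]] := pseudo_unramified_small_abelian_index_p hp hG le2 psN.
  by apply: prime_index_totally_unramified nsAG _; rewrite ?iA.
have [[/and3P[_ _ nsNG]] _] := psN; have [sNG nNG] := andP nsNG.
have pG: p.-group G by rewrite /pgroup hG pnatX pnat_id.
have abGN: abelian (G / N).
  apply: (p2group_abelian (quotient_pgroup N pG)).
  rewrite card_quotient // -divgS // logn_div ?cardSg // hG pfactorK //.
  by rewrite leq_subLR (leq_add gt2 (leqnn 2)).
apply: TotUnramStep (TotUnramAbelian abGN).
exact: pseudo_unramified_abelian_quotient.
Qed.
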